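(* Let $c\geq 3$ be an integer. For $k=1,2,\dots$ let $I_k=[(k-1)c,kc)$ and let $\chi_{I_k}=1$ if $I_k$ contains at least one prime and $\chi_{I_k}=0$ otherwise. Then for all sufficiently large $m$, \[ \frac{1}{c}\pi(mc)\leq\sum_{k=1}^{m}\chi_{I_k}<\pi(mc); \] consequently, for fixed $c$, $\sum_{k=1}^{m}\chi_{I_k}\asymp \frac{m}{\ln m}$ as $m\to\infty$.
   Context: $\pi(x)$ denotes the number of primes $\leq x$. The notation $f(m)\asymp g(m)$ means that $f(m)/g(m)$ is bounded above and below by positive constants (which may depend on $c$) for all large $m$. *)

(* Defs.v *)
From mathcomp Require Import all_boot all_order all_algebra.
From mathcomp Require Import all_classical all_reals all_analysis.

Set Implicit Arguments.
Unset Strict Implicit.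
Unset Printing Implicit Defensive.

Import Order.TTheory GRing.Theory Num.Theory.
Import numFieldNormedType.Exports.

Local Open Scope classical_set_scope.
Local Open Scope ring_scope.

Definition primepi (n : nat) : nat := #|[set p : 'I_n.+1 | prime p]%SET|.

(* The integers in the half-open interval [(k-1)c, kc); meaningful for k >= 1. *)
Definition block (c k : nat) : seq nat := index_iota (k.-1 * c) (k * c).

Definition chi (c k : nat) : nat := if has prime (block c k) then 1%N else 0%N.

Definition asymp (R : realType) (f g : nat -> R) : Prop :=
  exists a b : R, [/\ 0 < a, 0 < b & \forall m \near \oo, a <= f m / g m <= b].

(* Main.v *)
(** A block of length c contains at most c primes, and mc is composite for
    m >= 2, which bounds the number of occupied blocks below by pi(mc) / c.
    It is strictly less than pi(mc) because the first two blocks already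
    contain the three primes 2, 3 and 5. The order m / ln m then comes from
    Chebyshev's estimates. For the lower one, every prime power dividing
    C(n, k) is at most n, so 2^(n/2) <= C(n, n/2) <= n^pi(n). For the upper
    one, the product of the primes up to n is at most 4^n, so with
    s^2 <= n < (s+1)^2 the primes exceeding s give (s+1)^(pi(n) - s) <= 4^n. *)

Require Import Defs.
From mathcomp Require Import all_boot all_order all_algebra.
From mathcomp Require Import all_classical all_reals all_analysis.
From mathcomp Require Import zify lra.

Import Order.TTheory GRing.Theory Num.Theory.
Import numFieldNormedType.Exports.

Local Open Scope nat_scope.

Lemma primepiE n : primepi n = \sum_(0 <= i < n.+1) prime i.
Proof. by rewrite /primepi cardsE -sum1_card big_mkcond big_mkord. Qed.

Lemma leq_primepi m n : m <= n -> primepi m <= primepi n.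
Proof.
by move=> le_mn; rewrite !primepiE (@big_cat_nat _ _ _ m.+1 0 n.+1) //= leq_addr.
Qed.

Lemma primepi_le n : primepi n <= n.
Proof.
rewrite primepiE big_nat_recl //= add0n -[leqRHS]subn0 -[leqRHS]muln1.
by rewrite -sum_nat_const_nat; apply: leq_sum => i _; case: prime.
Qed.

(** * Prime powers in binomial coefficients and the lower Chebyshev bound *)

Lemma logn_fact_widen p k n : prime p -> k <= n ->
  logn p k`! = \sum_(1 <= i < n.+1) k %/ p ^ i.
Proof.
move=> p_pr le_kn; rewrite logn_fact // (@big_cat_nat _ _ _ k.+1 1 n.+1) //=.
rewrite [X in _ = _ + X]big_nat [X in _ = _ + X]big1 ?addn0 // => i /andP[lt_ki _].
by rewrite divn_small // (leq_trans lt_ki) // ltnW // ltn_expl ?prime_gt1.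
Qed.

(** By Legendre's formula, summed over one common range for all three factorials, the exponent
    counts the [i] at which adding [k] and [n - k] in base [p] carries; a carry requires
    [p ^ i <= n]. *)
Lemma logn_bin_le p n k : prime p -> k <= n ->
  logn p 'C(n, k) <= trunc_log p n.
Proof.
move=> p_pr le_kn; have p_gt1 := prime_gt1 p_pr.
have /(congr1 (logn p)) := bin_fact le_kn.
rewrite !lognM ?muln_gt0 ?fact_gt0 ?bin_gt0 //.
rewrite !(@logn_fact_widen p _ n) ?leq_subr // -big_split /= => eq_log.
rewrite -(leq_add2r (\sum_(1 <= i < n.+1) (k %/ p ^ i + (n - k) %/ p ^ i))).
rewrite eq_log.
have count_le : \sum_(1 <= i < n.+1) (p ^ i <= n) <= trunc_log p n.
  apply: (@leq_trans (\sum_(1 <= i < n.+1) (i <= trunc_log p n))).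
    apply: leq_sum => i _; have [le_pn|] := leqP (p ^ i) n => //.
    by rewrite trunc_log_max.
  (* Generalising the logarithm to any [t]: at most [t] of the indices [1..n] are [<= t]. *)
  elim: n {le_kn eq_log} (trunc_log p n) => [|n IHn] t; first by rewrite big_nil.
  rewrite big_nat_recr //=; case: t => [|t].
    by rewrite addn0; apply: leq_trans (IHn 0) _.
  have := IHn t.+1; have [lt_nt _|_] := leqP n.+1 t.+1; last by rewrite addn0.
  rewrite addn1; apply: leq_ltn_trans lt_nt.
  rewrite -[leqRHS]subn0 -[leqRHS]muln1 -subSS -sum_nat_const_nat.
  by apply: leq_sum => i _; apply: leq_b1.
apply: leq_trans (leq_add count_le (leqnn _)).
(* [divnD] isolates the carry, a single bit. It vanishes when [n < p ^ i], as the two remainders add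
   up to at most [n]. *)
rewrite -big_split /=; apply: leq_sum => i _; rewrite -{1}(subnKC le_kn).
rewrite divnD ?expn_gt0 ?prime_gt0 // addnC leq_add2r.
have [le_pn|lt_np] := leqP (p ^ i) n; first exact: leq_b1.
by rewrite leqn0 eqb0 -ltnNge (leq_ltn_trans _ lt_np) // -{2}(subnKC le_kn) leq_add ?leq_mod.
Qed.

Lemma bin_le_exp_primepi n k : k <= n -> 'C(n, k) <= n ^ primepi n.
Proof.
(* For [n = 0] the bound is [0 ^ 0 = 1]. *)
move=> le_kn; have [->|n_gt0] := posnP n.
  have := primepi_le 0; rewrite leqn0 => /eqP->.
  by rewrite bin0n; case: k {le_kn}.
rewrite [leqLHS]prod_prime_decomp ?bin_gt0 // prime_decompE big_map /=.
have pow_le p : p \in primes 'C(n, k) -> p ^ logn p 'C(n, k) <= n.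
  rewrite mem_primes => /and3P[p_pr _ _]; have p_gt1 := prime_gt1 p_pr.
  by rewrite (leq_trans _ (trunc_logP p_gt1 n_gt0)) // leq_exp2l // logn_bin_le.
apply: (@leq_trans (n ^ size (primes 'C(n, k)))).
  elim: (primes _) pow_le => [|p s IHs] pow_le; first by rewrite big_nil.
  rewrite big_cons /= expnS leq_mul ?pow_le ?mem_head //.
  by apply: IHs => q s_q; rewrite pow_le // in_cons s_q orbT.
rewrite leq_pexp2l // primepiE -big_mkcond /= sum1_count -size_filter.
apply: uniq_leq_size (primes_uniq _) _ => p p_in.
have := pow_le p p_in; move: p_in; rewrite mem_primes mem_filter mem_index_iota.
move=> /and3P[p_pr C_gt0 p_dvd] p_le; rewrite p_pr ltnS (leq_trans _ p_le) //.
by rewrite -{1}(expn1 p) leq_exp2l ?prime_gt1 // logn_gt0 mem_primes p_pr C_gt0.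
Qed.

(** In Vandermonde's sum of ['C(k, i) * 'C(l, k - i)] each second factor is positive since [k <= l],
    and the first factors add up to [2 ^ k]. *)
Lemma exp2_le_bin k l : k <= l -> 2 ^ k <= 'C(k + l, k).
Proof.
move=> le_kl; rewrite -binomial.Vandermonde -[2]/(1 + 1) expnDn.
apply: leq_sum => i _; rewrite !exp1n !muln1 leq_pmulr // bin_gt0.
exact: leq_trans (leq_subr _ _) le_kl.
Qed.

Lemma exp2_le_exp_primepi n : 2 ^ n./2 <= n ^ primepi n.
Proof.
apply: leq_trans (@bin_le_exp_primepi n n./2 _); last by lia.
have {2}-> : n = n./2 + uphalf n by lia.
by apply: exp2_le_bin; lia.
Qed.

(** * The primorial and the upper Chebyshev bound *)

Lemma prod_primes_dvdn (s : seq nat) N : uniq s ->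
  {in s, forall p, prime p && (p %| N)} -> \prod_(p <- s) p %| N.
Proof.
elim: s => [|p s IHs] /=; first by rewrite big_nil dvd1n.
move=> /andP[s'p Us] s_dvd; rewrite big_cons.
have /andP[p_pr p_dvd] := s_dvd p (mem_head _ _).
rewrite Gauss_dvd ?p_dvd /=; last first.
  rewrite prime_coprime // Euclid_dvd_prod // big_has.
  apply/hasPn => q s_q; rewrite dvdn_prime2 //.
    by apply: contraNneq s'p => ->.
  by have /andP[] := s_dvd q (@mem_behead _ (p :: s) q s_q).
by apply: IHs => // q s_q; apply: s_dvd; rewrite in_cons s_q orbT.
Qed.

Lemma prime_ndvd_fact p n : prime p -> n < p -> ~~ (p %| n`!).
Proof.
move=> p_pr lt_np; rewrite fact_prod Euclid_dvd_prod // big_has.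
apply/hasPn => i; rewrite mem_index_iota ltnS => /andP[i_gt0 le_in].
by rewrite gtnNdvd // (leq_ltn_trans le_in).
Qed.

Lemma prime_dvd_bin p n k : prime p -> k <= n -> k < p -> n - k < p -> p <= n ->
  p %| 'C(n, k).
Proof.
move=> p_pr le_kn lt_kp lt_nkp le_pn.
have : p %| n`! by rewrite dvdn_fact // prime_gt0.
rewrite -(bin_fact le_kn) !Euclid_dvdM //.
rewrite (negPf (@prime_ndvd_fact p k _ _)) //.
by rewrite (negPf (@prime_ndvd_fact p (n - k) _ _)) // !orbF.
Qed.

(** The equal coefficients at [m] and [m.+1] both occur in the expansion of
    [(1 + 1) ^ m.*2.+1 = 2 * 4 ^ m]. *)
Lemma bin_odd_le m : 'C(m.*2.+1, m) <= 4 ^ m.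
Proof.
have le_m : m <= m.*2.+1 by lia.
rewrite -(@leq_pmul2l 2) // -[4]/(2 ^ 2) -expnM mul2n -expnS mul2n -addnn.
rewrite -{2}bin_sub //.
have -> : m.*2.+1 - m = m.+1 by lia.
rewrite -[2 in leqRHS]/(1 + 1) expnDn.
have lt_m : m < m.*2.+2 by lia.
have lt_m1 : m.+1 < m.*2.+2 by lia.
rewrite (bigD1 (Ordinal lt_m)) //= (bigD1 (Ordinal lt_m1)) /=; last first.
  by rewrite -val_eqE /= gtn_eqF.
by rewrite !exp1n !muln1 addnA leq_addr.
Qed.

(** Strong induction. An even [n > 2] adds no prime to the product for [n - 1]. For [n = 2m + 1],
    induction handles the primes up to [m + 1], and the remaining ones all divide
    ['C(2m + 1, m)]. *)
Lemma primorial_le n : \prod_(0 <= p < n.+1 | prime p) p <= 4 ^ n.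
Proof.
have [k] := ubnP n; elim: k n => // k IHk n; rewrite ltnS => le_nk.
case: (boolP (odd n)) => [odd_n|even_n]; last first.
  case: n le_nk even_n => [|[|[|n]]] // le_nk even_n; [by rewrite unlock | by rewrite unlock |].
  rewrite big_mkcond big_nat_recr //= -big_mkcond /=.
  case: ifP => [/even_prime[]|_]; rewrite ?(negPf even_n) //.
  by rewrite muln1 (leq_trans (IHk _ _)) // leq_exp2l.
pose m := n./2; have n_eq : n = m.*2.+1 by rewrite /m; lia.
(* At [m = 0], [m + 1] equals [n], so the induction hypothesis would not apply. *)
case: (posnP m) => [m0|m_gt0]; first by rewrite n_eq m0 !unlock.
rewrite (@big_cat_nat _ _ _ m.+2 0 n.+1) //=; last by lia.
have -> : 4 ^ n = 4 ^ m.+1 * 4 ^ m by rewrite -expnD; congr (_ ^ _); lia.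
rewrite leq_mul ?IHk //; first by lia.
apply: leq_trans (bin_odd_le m).
apply: dvdn_leq; first by rewrite bin_gt0; lia.
rewrite -big_filter; apply: prod_primes_dvdn.
  by rewrite filter_uniq // iota_uniq.
move=> p; rewrite mem_filter mem_index_iota => /and3P[p_pr lt_mp lt_pn].
by rewrite p_pr prime_dvd_bin //; lia.
Qed.

Lemma exp_primepi_le n s : s <= n -> s.+1 ^ (primepi n - s) <= 4 ^ n.
Proof.
move=> le_sn; apply: leq_trans (primorial_le n).
apply: (@leq_trans (s.+1 ^ \sum_(s.+1 <= p < n.+1) prime p)).
  (* At most [s] primes are [<= s], so at least [primepi n - s] lie above [s]. *)
  rewrite leq_pexp2l // leq_subLR.
  apply: leq_trans (leq_add (primepi_le s) (leqnn _)).
  by rewrite !primepiE -big_cat_nat.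
rewrite (@big_cat_nat _ _ _ s.+1 0 n.+1) //= expn_sum.
rewrite [leqLHS]big_nat big_mkcond /= -[leqLHS]mul1n leq_mul //.
  rewrite prodn_cond_gt0 // => p; exact: prime_gt0.
rewrite [leqRHS]big_nat_cond [leqRHS]big_mkcond; apply: leq_prod => p _.
case: (boolP (_ && _)) => //= /andP[lt_sp _].
by case: prime; rewrite ?expn1 ?expn0.
Qed.

(** * Occupied blocks against primes *)

Lemma sum_chi_bounds c m :
  \sum_(1 <= k < m.+1) chi c k <= \sum_(0 <= i < m * c) prime i
    <= c * \sum_(1 <= k < m.+1) chi c k.
Proof.
elim: m => [|m /andP[IH1 IH2]]; first by rewrite mul0n !big_nil.
rewrite (@big_cat_nat _ _ _ (m * c) 0 (m.+1 * c)) ?leq_mul //.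
rewrite [X in X <= _]big_nat_recr // [X in _ <= _ * X]big_nat_recr // mulnDr.
have /andP[b1 b2] :
    chi c m.+1 <= \sum_(m * c <= i < m.+1 * c) prime i <= c * chi c m.+1.
  rewrite /chi /block /= -big_mkcond sum1_count has_count; case: ltnP => h.
    by rewrite h muln1 (leq_trans (count_size _ _)) // size_iota mulSn addnK.
  by move: h; rewrite leqn0 => /eqP ->.
by rewrite !leq_add.
Qed.

Lemma sum_chi_lt c m : 2 < c -> 1 < m ->
  \sum_(1 <= k < m.+1) chi c k < \sum_(0 <= i < m * c) prime i.
Proof.
move=> c_gt2; elim: m => // m IHm; rewrite ltnS leq_eqVlt => /predU1P[<-|m_gt1].
  (* Base case [m = 2]: two blocks count at most 2, while 2, 3, 5 lie below [6 <= 2 * c]. Later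
     blocks preserve the strict gap. *)
  apply: (@leq_trans (\sum_(0 <= i < 6) prime i)).
    have -> : \sum_(0 <= i < 6) prime i = 3 by rewrite unlock.
    rewrite big_nat_recr // big_nat1 ltnS.
    by apply: (@leq_add _ _ 1 1); rewrite /chi; case: has.
  by rewrite (@big_cat_nat _ _ _ 6 0 (2 * c)) ?leq_addr //; lia.
rewrite (@big_cat_nat _ _ _ (m * c) 0 (m.+1 * c)) ?leq_mul // big_nat_recr //.
rewrite -addSn leq_add ?IHm //.
rewrite /chi /block /= -big_mkcond sum1_count has_count; by case: ltnP.
Qed.

(** The blocks stop just before [m * c], whereas [primepi] includes that endpoint, which is
    composite. *)
Lemma primepi_mul c m : 1 < c -> 1 < m ->
  primepi (m * c) = \sum_(0 <= i < m * c) prime i.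
Proof.
move=> c_gt1 m_gt1; rewrite primepiE big_nat_recr //=.
case: primeP => [[_ /(_ m)]|_]; last by rewrite addn0.
by rewrite dvdn_mulr // => /(_ isT) /orP[]/eqP; nia.
Qed.

(** * Chebyshev's estimates in logarithmic form *)

Lemma sqrtn_bounds n : exists s, s ^ 2 <= n < s.+1 ^ 2.
Proof.
elim: n => [|n [s /andP[le_sn lt_ns]]]; first by exists 0.
have [->|lt_n1] := eqVneq n.+1 (s.+1 ^ 2); last by exists s; lia.
by exists s.+1; rewrite leqnn ltn_sqr /=.
Qed.

Local Open Scope ring_scope.

Lemma ln_expn_le (R : realType) a k b l : (0 < a)%N -> (0 < b)%N ->
  (a ^ k <= b ^ l)%N -> k%:R * ln a%:R <= l%:R * ln b%:R :> R.
Proof.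
move=> a_gt0 b_gt0 le_ab; rewrite !mulr_natl -!lnXn ?ltr0n //.
by rewrite ler_ln ?posrE ?exprn_gt0 ?ltr0n // -!natrX ler_nat.
Qed.

Lemma primepi_ln_ge (R : realType) n : (1 < n)%N ->
  n%:R * ln 2 <= 3 * ((primepi n)%:R * ln n%:R) :> R.
Proof.
move=> n_gt1; have n_gt0 := ltnW n_gt1.
have := @ln_expn_le R _ _ _ _ (ltn0Sn 1) n_gt0 (exp2_le_exp_primepi n).
(* The constant 3 absorbs the rounding in [n./2]; equality holds at [n = 3]. *)
have : n%:R <= 3 * (n./2)%:R :> R by rewrite -natrM ler_nat; lia.
have : 0 <= ln 2 :> R by rewrite ln_ge0 // ler1n.
by nra.
Qed.

(** With [s] the integer square root, [ln n <= 2 * ln (s + 1)]. The primes beyond the first [s]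
    contribute at most [2 * n * ln 4], and the first [s] at most
    [2 * s * ln (s + 1) <= 2 * s ^ 2 <= 2 * n]. *)
Lemma primepi_ln_le (R : realType) n : (0 < n)%N ->
  (primepi n)%:R * ln n%:R <= (2 * ln 4 + 2) * n%:R :> R.
Proof.
move=> n_gt0; have [s /andP[le_sn lt_ns]] := sqrtn_bounds n.
have s_le_n : (s <= n)%N by rewrite (leq_trans _ le_sn) //; nia.
have exp_le := @exp_primepi_le n s s_le_n.
have := @ln_expn_le R _ _ _ _ (ltn0Sn s) (ltn0Sn 3) exp_le.
have ln_n_le : ln n%:R <= 2 * ln s.+1%:R :> R.
  have := @ln_expn_le R n 1 s.+1 2 n_gt0 (ltn0Sn s) (ltnW lt_ns).
  by rewrite mul1r.
have ln_s_le : ln s.+1%:R <= s%:R :> R.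
  by rewrite -natr1 addrC le_ln1Dx // (lt_le_trans (ltrN10 R)).
have ln_s_ge0 : 0 <= ln s.+1%:R :> R by rewrite ln_ge0 // ler1n.
(* Only an inequality, because the natural subtraction truncates at 0. *)
have pi_le : (primepi n)%:R <= (primepi n - s)%:R + s%:R :> R.
  by rewrite -natrD ler_nat; lia.
have s2_le : s%:R * s%:R <= n%:R :> R by rewrite -natrM ler_nat mulnn.
have pi_ge0 : 0 <= (primepi n)%:R :> R by [].
move=> cheb.
have h1 := ler_wpM2l pi_ge0 ln_n_le.
have h2 := ler_wpM2r ln_s_ge0 pi_le.
have h3 := ler_wpM2l (ler0n R s) ln_s_le.
by move: cheb h1 h2 h3; rewrite mulrDl; lra.
Qed.

Local Open Scope classical_set_scope.

Theorem theorem4 (R : realType) (c : nat) (hc : (3 <= c)%N) :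
  (\forall m \near \oo,
     c%:R^-1 * (primepi (m * c))%:R <= \sum_(1 <= k < m.+1) (chi c k)%:R :> R
     /\ \sum_(1 <= k < m.+1) (chi c k)%:R < (primepi (m * c))%:R :> R)
  /\ asymp (fun m : nat => \sum_(1 <= k < m.+1) (chi c k)%:R : R)
           (fun m : nat => m%:R / ln m%:R).
Proof.
have c_gt0 : 0 < c%:R :> R by rewrite ltr0n; lia.
have blocks m : (1 < m)%N ->
    (primepi (m * c) <= c * \sum_(1 <= k < m.+1) chi c k)%N
    /\ (\sum_(1 <= k < m.+1) chi c k < primepi (m * c))%N.
  move=> m_gt1; rewrite primepi_mul //; last by lia.
  by split; [case/andP: (sum_chi_bounds c m) | apply: sum_chi_lt].
split.
  exists 2%N => // m /= /blocks[le_pi lt_pi]; rewrite -natr_sum ltr_nat.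
  by rewrite ler_pdivrMl // -natrM ler_nat.
have ln2_gt0 : 0 < ln 2 :> R by rewrite ln_gt0 // ltr1n.
have ln4_ge0 : 0 <= ln 4 :> R by rewrite ln_ge0 // ler1n.
(* The lower constant combines [primepi m <= primepi (m * c) <= c * S] with the lower estimate at
   [m]; the upper one combines [S < primepi (m * c)] and [ln m <= ln (m * c)] with the upper
   estimate at [m * c]. *)
exists (ln 2 / (3 * c%:R)), ((2 * ln 4 + 2) * c%:R); split.
- by rewrite divr_gt0 // mulr_gt0.
- by rewrite mulr_gt0 // ltr_wpDl ?mulr_ge0.
exists 2%N => // m /= m_gt1; have [le_pi lt_pi] := blocks m m_gt1.
have m_gt0 : 0 < m%:R :> R by rewrite ltr0n ltnW.
have lnm_gt0 : 0 < ln m%:R :> R by rewrite ln_gt0 // ltr1n.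
rewrite -natr_sum; set S := (\sum_(_ <= _ < _) _)%N in le_pi lt_pi *.
rewrite invf_div mulrA ler_pdivlMr // ler_pdivrMr //; apply/andP; split.
  rewrite mulrAC ler_pdivrMr ?mulr_gt0 // mulrC.
  apply: le_trans (primepi_ln_ge _ m m_gt1) _.
  have pi_le : (primepi m)%:R <= c%:R * S%:R :> R.
    by rewrite -natrM ler_nat (leq_trans _ le_pi) // leq_primepi // leq_pmulr; lia.
  by have := ler_wpM2r (ltW lnm_gt0) pi_le; lra.
have := primepi_ln_le R (m * c); rewrite muln_gt0 (ltnW m_gt1) => cheb.
rewrite -mulrA [c%:R * _]mulrC -natrM; apply: le_trans (cheb _); last by lia.
apply: ler_pM => //; first exact: ltW.
  by rewrite ler_nat ltnW.
by rewrite ler_ln ?posrE ?ltr0n ?muln_gt0 ?ler_nat ?leq_pmulr //; lia.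
Qed.
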